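(* Let $X$ be a real random variable and $g:\mathbb R\to\mathbb R$ a measurable function such that $\mathbb E[e^{\eta g(X)}]<\infty$ for all $\eta>0$ and $\mathbb P(g(X)>0)>0$. Let $X_1,X_2,\dots$ be i.i.d. copies of $X$. For $\theta>0$ and $n\ge 1$ put $$F_\theta(x)=\frac{\mathbb E[e^{\theta g(X)}\mathbf 1_{X\le x}]}{\mathbb E[e^{\theta g(X)}]},\qquad F_{n,\theta}(x)=\frac{\sum_{i=1}^n e^{\theta g(X_i)}\mathbf 1_{X_i\le x}}{\sum_{i=1}^n e^{\theta g(X_i)}},\qquad M_\theta=\frac{\mathbb E[e^{2\theta g(X)}]}{\mathbb E[e^{\theta g(X)}]^2}.$$ Let $(\theta_n)_{n\ge1}$ be a sequence of positive real numbers. If $\lim_{n\to\infty} M_{\theta_n}/n=0$, then for every sequence $(s_n)$ of positive real numbers with $\lim_{n\to\infty}s_n^2\,M_{\theta_n}/n=0$, $$s_n\,\sup_{x\in\mathbb R}|F_{n,\theta_n}(x)-F_{\theta_n}(x)|\xrightarrow{d}0\qquad(n\to\infty).$$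
   Context: $\xrightarrow{d}$ denotes convergence in distribution of real random variables. The random variable $X$ is allowed to have atoms. *)

(* Defs.v *)
From HB Require Import structures.
From mathcomp Require Import all_boot all_order all_algebra.
From mathcomp Require Import all_classical all_reals all_analysis.
From mathcomp Require Import measurable_realfun.
From mathcomp Require Import lra.

Set Implicit Arguments.
Unset Strict Implicit.
Unset Printing Implicit Defensive.

Import Order.TTheory GRing.Theory Num.Theory.
Import numFieldNormedType.Exports.

Local Open Scope classical_set_scope.
Local Open Scope ring_scope.

Definition mutually_independent d (T : measurableType d) (R : realType)
    (P : probability T R) (X : nat -> {RV P >-> R}) : Prop :=
  forall (J : seq nat) (A : nat -> set R), uniq J ->
    (forall i, i \in J -> measurable (A i)) ->
    P (\bigcap_(i in [set` J]) X i @^-1` A i) =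
    (\prod_(i <- J) P (X i @^-1` A i))%E.

Definition same_distribution d0 d (T0 : measurableType d0) (T : measurableType d)
    (R : realType) (Q : probability T0 R) (P : probability T R)
    (X : {RV Q >-> R}) (Y : {RV P >-> R}) : Prop :=
  forall A : set R, measurable A -> distribution P Y A = distribution Q X A.

(* Pointwise convergence of the distribution functions at the continuity points
   of the limit one. *)
Definition cvg_in_distribution d (T : measurableType d) (R : realType)
    (P : probability T R) (Y : nat -> {RV P >-> R}) (Z : {RV P >-> R}) : Prop :=
  forall x : R, {for x, continuous (cdf Z)} ->
    cdf (Y n) x @[n --> \oo] --> cdf Z x.

(* The sample is 0-based: [Xs i] is the (i+1)-st copy of [X], so the first [n]
   copies are [Xs i] for [i < n]. The value at [n = 0] is a junk one (0 / 0 = 0).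
   [fine] only turns a finite expectation into a real number; it would be 0 on an
   infinite one. *)
Section tilted.
Context d0 (T0 : measurableType d0) (R : realType) (Q : probability T0 R).
Variables (X : {RV Q >-> R}) (g : {mfun R >-> R}).

Definition tilted_cdf (theta x : R) : R :=
  fine 'E_Q[fun w => expR (theta * g (X w)) * \1_(`]-oo, x]) (X w)] /
  fine 'E_Q[fun w => expR (theta * g (X w))].

Definition tilted_M (theta : R) : R :=
  fine 'E_Q[fun w => expR (2 * theta * g (X w))] /
  fine 'E_Q[fun w => expR (theta * g (X w))] ^+ 2.

Context d (T : measurableType d) (P : probability T R).
Variable Xs : nat -> {RV P >-> R}.

Definition tilted_ecdf (n : nat) (theta : R) (w : T) (x : R) : R :=
  (\sum_(i < n) expR (theta * g (Xs i w)) * \1_(`]-oo, x]) (Xs i w)) /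
  (\sum_(i < n) expR (theta * g (Xs i w))).

Definition tilted_sup_dist (n : nat) (theta : R) (w : T) : R :=
  sup (range (fun x => `|tilted_ecdf n theta w x - tilted_cdf theta x|)).

(* [tilted_sup_dist] is measurable because the supremum can be taken over the
   rationals, both distribution functions being right-continuous. *)
Lemma measurable_tilt (theta : R) :
  measurable_fun setT (fun w => expR (theta * g (X w))).
Proof.
apply: measurableT_comp => //; apply: measurable_funM => //.
exact: measurableT_comp.
Qed.

Lemma measurable_tilt_le (theta x : R) :
  measurable_fun setT
    (fun w => expR (theta * g (X w)) * \1_(`]-oo, x]) (X w)).
Proof.
apply: measurable_funM; first exact: measurable_tilt.
by apply: measurableT_comp => //; exact: measurable_indic.
Qed.

Lemma tilt_integrable (theta : R) :
  fine 'E_Q[fun w => expR (theta * g (X w))] != 0 ->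
  Q.-integrable setT (fun w => (expR (theta * g (X w)))%:E).
Proof.
rewrite unlock => H; apply/integrableP; split.
  by apply/measurable_EFinP; exact: measurable_tilt.
under eq_integral do rewrite gee0_abs ?lee_fin ?expR_ge0//.
rewrite ltey; apply/eqP => E; move: H; rewrite E /= eqxx //.
Qed.

Lemma indic_itvNyc (y x : R) : \1_(`]-oo, x]) y = (y <= x)%R%:R :> R.
Proof. by rewrite indicE mem_setE in_itv. Qed.

Lemma cvg_indic_right (y x : R) (u : nat -> R) :
  (forall n, x < u n) -> u n @[n --> \oo] --> x ->
  \forall n \near \oo, \1_(`]-oo, u n]) y = \1_(`]-oo, x]) y :> R.
Proof.
move=> ux uxx; have [yx|yx] := leP y x.
  by near=> n; rewrite !indic_itvNyc yx (le_trans yx)// ltW.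
near=> n; rewrite !indic_itvNyc !leNgt yx; congr (~~ _)%:R.
by near: n; apply: cvgr_lt uxx _ yx.
Unshelve. all: by end_near. Qed.

Lemma tilted_cdf_right (theta x : R) :
  tilted_cdf theta y @[y --> x^'+] --> tilted_cdf theta x.
Proof.
rewrite /tilted_cdf; set c := fine _.
have [->|c0] := eqVneq c 0.
  by rewrite invr0 mulr0; under eq_cvg do rewrite mulr0; exact: cvg_cst.
apply: cvgM; last exact: cvg_cst.
have ig := tilt_integrable c0.
apply/cvg_at_rightP => u [ux uxx]; rewrite unlock.
have [h1 _ h3] := @dominated_convergence _ _ _ Q setT measurableT
  (fun n w => (expR (theta * g (X w)) * \1_(`]-oo, u n]) (X w))%:E)
  (fun w => (expR (theta * g (X w)) * \1_(`]-oo, x]) (X w))%:E)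
  (fun w => (expR (theta * g (X w)))%:E)
  (fun n => proj2 (measurable_EFinP _ _) (measurable_tilt_le _ _))
  (proj2 (measurable_EFinP _ _) (measurable_tilt_le _ _))
  ltac:(apply: aeW => w _; apply: cvg_near_cst;
    apply: filterS (cvg_indic_right (X w) ux uxx) => n ->; exact: erefl) ig
  ltac:(by apply: aeW => w n _; rewrite lee_fin normrM !ger0_norm ?expR_ge0//
    ler_piMr ?expR_ge0// indicE lern1 leq_b1).
apply: fine_cvg; rewrite fineK; first exact: h3.
exact: integrable_fin_num.
Qed.

Lemma tilted_ecdf_right n (theta x : R) w :
  tilted_ecdf n theta w y @[y --> x^'+] --> tilted_ecdf n theta w x.
Proof.
apply: cvgM; last exact: cvg_cst.
apply: cvg_big => [|i _]; first exact: add_continuous.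
apply: cvgM; first exact: cvg_cst.
apply/cvg_at_rightP => u [ux uxx]; apply: cvg_near_cst.
exact: cvg_indic_right.
Qed.

Lemma indic_le1 (A : set R) y : 0 <= (\1_A y : R) <= 1.
Proof. by rewrite indicE ler0n lern1 leq_b1. Qed.

Lemma tilted_cdf_itv (theta x : R) : 0 <= tilted_cdf theta x <= 1.
Proof.
rewrite /tilted_cdf; set c := (X in _ / X).
have [->|c0] := eqVneq c 0; first by rewrite invr0 mulr0 lexx ler01.
have ig := tilt_integrable c0.
have cp : 0 < c.
  rewrite lt_def c0/= /c unlock; apply: fine_ge0; apply: integral_ge0 => w _.
  by rewrite lee_fin expR_ge0.
have ge0 w : 0 <= expR (theta * g (X w)) * \1_(`]-oo, x]) (X w) :> R.
  by rewrite mulr_ge0 ?expR_ge0//; case/andP: (indic_le1 `]-oo, x] (X w)).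
have le1 w : expR (theta * g (X w)) * \1_(`]-oo, x]) (X w)
    <= expR (theta * g (X w)) :> R.
  by rewrite ler_piMr ?expR_ge0//; case/andP: (indic_le1 `]-oo, x] (X w)).
have le : ('E_Q[(fun w => expR (theta * g (X w)) * \1_(`]-oo, x]) (X w))%R]
    <= 'E_Q[(fun w => expR (theta * g (X w)))%R])%E.
  rewrite unlock; apply: ge0_le_integral => //.
  - by apply/measurable_EFinP; exact: measurable_tilt_le.
  - by apply/measurable_EFinP; exact: measurable_tilt.
  - by move=> w _; rewrite lee_fin.
have fin : 'E_Q[(fun w => expR (theta * g (X w)))%R]%E \is a fin_num.
  by rewrite unlock; exact: integrable_fin_num.
have num0 :
    (0 <= 'E_Q[(fun w => expR (theta * g (X w)) * \1_(`]-oo, x]) (X w))%R])%E.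
  by rewrite unlock; apply: integral_ge0 => w _; rewrite lee_fin.
apply/andP; split; first by apply: divr_ge0; [exact: fine_ge0|exact: ltW].
rewrite ler_pdivrMr// mul1r fine_le// ge0_fin_numE//.
by rewrite (le_lt_trans le)// ltey_eq fin.
Qed.

Lemma tilted_ecdf_itv n (theta x : R) w : 0 <= tilted_ecdf n theta w x <= 1.
Proof.
rewrite /tilted_ecdf; set c := (X in _ / X).
have c0 : 0 <= c by apply: sumr_ge0 => i _; exact: expR_ge0.
apply/andP; split.
  apply: divr_ge0 => //; apply: sumr_ge0 => i _; apply: mulr_ge0.
    exact: expR_ge0.
  by case/andP: (indic_le1 `]-oo, x] (Xs (nat_of_ord i) w)).
have [->|cn0] := eqVneq c 0; first by rewrite invr0 mulr0 ler01.
rewrite ler_pdivrMr ?lt_def ?cn0// mul1r; apply: ler_sum => i _.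
by rewrite ler_piMr ?expR_ge0//; case/andP: (indic_le1 `]-oo, x] (Xs i w)).
Qed.

Lemma tilted_dist_le1 n (theta x : R) w :
  `|tilted_ecdf n theta w x - tilted_cdf theta x| <= 1.
Proof.
have /andP[a0 a1] := tilted_cdf_itv theta x.
have /andP[b0 b1] := tilted_ecdf_itv n theta x w.
by rewrite ler_norml; apply/andP; split; lra.
Qed.

Lemma tilted_sup_distE n (theta : R) :
  tilted_sup_dist n theta = (fun w => sups (fun k =>
    `|tilted_ecdf n theta w (ratr (odflt 0 (unpickle k)))
      - tilted_cdf theta (ratr (odflt 0 (unpickle k)))|) 0).
Proof.
apply/funext => w; rewrite /tilted_sup_dist /sups /=; set D := fun x => `|_|.
set r : nat -> R := fun k => ratr (odflt 0 (unpickle k)).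
have ub : has_ubound (range D) by exists 1 => _ [x _ <-]; exact: tilted_dist_le1.
have ub' : has_ubound (sdrop (fun k => D (r k)) 0).
  by exists 1 => _ [k _ <-]; exact: tilted_dist_le1.
apply/eqP; rewrite eq_le; apply/andP; split; last first.
  apply: ge_sup; first by exists (D (r 0%N)); exists 0%N.
  by move=> _ [k _ <-]; apply: ub_le_sup => //; exists (r k).
apply: ge_sup; first by exists (D 0); exists 0.
move=> _ [x _ <-]; rewrite leNgt; apply/negP => lt.
have Dr : D y @[y --> x^'+] --> D x.
  apply: cvg_norm; apply: cvgB; first exact: tilted_ecdf_right.
  exact: tilted_cdf_right.
have : \forall y \near x^'+, sup (sdrop (fun k => D (r k)) 0) < D y.
  exact: cvgr_gt Dr _ lt.
case=> e /= e0 He.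
have /rat_in_itvoo[q] : x < x + e by rewrite ltrDl.
rewrite in_itv/= => /andP[xq qe].
have := He (ratr q); rewrite /ball_/= distrC gtr0_norm ?subr_gt0//.
rewrite ltrBlDl => /(_ qe xq); apply/negP; rewrite -leNgt.
apply: ub_le_sup => //; exists (pickle q) => //.
by rewrite /r pickleK.
Qed.

Lemma measurable_tilted_ecdf n (theta x : R) :
  measurable_fun setT (fun w => tilted_ecdf n theta w x).
Proof.
have mX i : measurable_fun setT (fun w => expR (theta * g (Xs i w))).
  apply: measurableT_comp => //; apply: measurable_funM => //.
  exact: measurableT_comp.
rewrite /tilted_ecdf; apply: measurable_funM.
  apply: measurable_sum => i; apply: measurable_funM; first exact: (mX i).
  by apply: measurableT_comp => //; exact: measurable_indic.
under eq_fun do rewrite -powR_inv1 ?sumr_ge0//.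
apply: (measurableT_comp (measurable_powR _)) => //; exact: measurable_sum.
Qed.

Lemma measurable_tilted_sup_dist n (theta : R) :
  measurable_fun setT (tilted_sup_dist n theta).
Proof.
rewrite tilted_sup_distE; apply: measurable_fun_sups => [w _|k].
  by exists 1 => _ [k _ <-]; exact: tilted_dist_le1.
apply: measurableT_comp => //; apply: measurable_funB => //.
exact: measurable_tilted_ecdf.
Qed.

HB.instance Definition _ n theta :=
  isMeasurableFun.Build _ _ _ _ (tilted_sup_dist n theta)
    (measurable_tilted_sup_dist n theta).

End tilted.

(* Main.v *)
(**
  Write [f = exp (theta g) / E exp (theta g(X))]. Up to normalisation by the
  total weight, the numerator of the empirical distribution function is, on a
  finite grid of points, the partial-sum process [S_k] obtained by summing the
  centred variables [f(X_i) 1_(X_i <= x_k)]. It is enough to show that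
  [E max_k S_k^2 <= c n E f(X)^2 = c n M] with [c] independent of the grid:
  Chebyshev's inequality then bounds the tail of the supremum over a countable
  dense set, without any loss of a logarithmic factor.

  The increments of [S] over disjoint cells [I], [J] satisfy
  [E S(I)^2 S(J)^2 <= 5 n^2 nu(I) nu(J)], where [nu] has density [f^2] with
  respect to the law of [X]; this only involves second moments of [f] because
  the truncations of [f] to [I] and [J] have product zero. Billingsley's
  bisection argument turns such a bound into a fourth-moment bound for
  [max_k min(|S_k - S_i|, |S_j - S_k|)], hence into the maximal inequality.
*)
Require Import Defs.
From HB Require Import structures.
From mathcomp Require Import all_boot all_order all_algebra.
From mathcomp Require Import all_classical all_reals all_analysis.
From mathcomp Require Import measurable_realfun ring lra zify.

Set Implicit Arguments.
Unset Strict Implicit.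
Unset Printing Implicit Defensive.

Import Order.TTheory GRing.Theory Num.Theory.
Import numFieldNormedType.Exports.

Local Open Scope classical_set_scope.
Local Open Scope ring_scope.

(** * Functions all of whose moments are finite *)

Section all_moments.
Context d (T : measurableType d) (R : realType) (P : probability T R).
Implicit Types (f g h : T -> R).

(** Asking for every absolute moment gives a class closed under sums, products, powers, maxima and
    minima, so that integrability side conditions follow from the shape of an expression. *)
Definition all_moments f : Prop :=
  measurable_fun setT f /\
  forall k, P.-integrable setT (fun x => (`|f x| ^+ k)%:E).

Lemma integrable_le f g : measurable_fun setT f ->
  P.-integrable setT (EFin \o g) -> (forall x, `|f x| <= g x) ->
  P.-integrable setT (EFin \o f).
Proof.
move=> mf ig fg; apply: (le_integrable _ _ _ ig) => //.
  exact/measurable_EFinP.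
move=> x _ /=; rewrite lee_fin; exact: le_trans (fg x) (ler_norm _).
Qed.

Lemma all_moments_integrable f : all_moments f -> P.-integrable setT (EFin \o f).
Proof. by move=> [mf /(_ 1%N) H]; exact: integrable_le mf H _. Qed.

Lemma all_moments_norm f : all_moments f -> all_moments (fun x => `|f x|).
Proof.
move=> [mf H]; split; first exact: measurableT_comp.
by move=> k; under eq_fun do rewrite normr_id.
Qed.

Lemma all_moments_le f g : measurable_fun setT f -> all_moments g ->
  (forall x, `|f x| <= `|g x|) -> all_moments f.
Proof.
move=> mf [mg H] fg; split => // k.
apply: (integrable_le _ (H k)).
  by apply: measurable_funX; exact: measurableT_comp.
by move=> x; rewrite ger0_norm ?exprn_ge0// lerXn2r ?nnegrE.
Qed.

Lemma all_moments_cst (r : R) : all_moments (fun=> r).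
Proof.
split => // k; apply/integrableP; split => //.
rewrite integral_cst//= probability_setT mule1; exact: ltry.
Qed.

Lemma all_moments_add f g :
  all_moments f -> all_moments g -> all_moments (fun x => f x + g x).
Proof.
move=> [mf If] [mg Ig]; split; first exact: measurable_funD.
move=> k; pose b x := 2 ^+ k * (`|f x| ^+ k + `|g x| ^+ k) : R.
apply: (@integrable_le _ b).
- apply: measurable_funX; apply: measurableT_comp => //; exact: measurable_funD.
- rewrite /b (_ : EFin \o _ = (fun x => (2 ^+ k)%:E *
    ((`|f x| ^+ k)%:E + (`|g x| ^+ k)%:E))%E) //.
  by apply: integrableZl => //; exact: integrableD.
move=> x; rewrite ger0_norm ?exprn_ge0// /b.
have m0 : 0 <= Num.max `|f x| `|g x| by rewrite le_max normr_ge0.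
apply: (@le_trans _ _ ((2 * Num.max `|f x| `|g x|) ^+ k)).
  rewrite lerXn2r ?nnegrE ?mulr_ge0//.
  rewrite (le_trans (ler_normD _ _))// mulr2n mulrDl mul1r.
  by rewrite lerD// le_max lexx ?orbT.
rewrite exprMn ler_wpM2l ?exprn_ge0//.
by case: (leP `|f x| `|g x|) => _; [rewrite lerDr|rewrite lerDl];
  exact: exprn_ge0.
Qed.

Lemma all_moments_mul f g :
  all_moments f -> all_moments g -> all_moments (fun x => f x * g x).
Proof.
move=> [mf If] [mg Ig]; split; first exact: measurable_funM.
(* A product of two nonnegative numbers is at most the sum of their squares, so moments of order
   [2k] of the factors dominate the [k]-th moment of the product. *)
move=> k; pose b x := `|f x| ^+ k.*2 + `|g x| ^+ k.*2 : R.
apply: (@integrable_le _ b).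
- apply: measurable_funX; apply: measurableT_comp => //; exact: measurable_funM.
- by rewrite /b (_ : EFin \o _ = (fun x => ((`|f x| ^+ k.*2)%:E
    + (`|g x| ^+ k.*2)%:E))%E) //; exact: integrableD.
move=> x; rewrite ger0_norm ?exprn_ge0// /b normrM exprMn -muln2 !exprM.
have := sqr_ge0 (`|f x| ^+ k - `|g x| ^+ k).
have := exprn_ge0 k (normr_ge0 (f x)); have := exprn_ge0 k (normr_ge0 (g x)).
nra.
Qed.

Lemma all_moments_exp f k : all_moments f -> all_moments (fun x => f x ^+ k).
Proof.
move=> If; elim: k => [|k ih].
  by under eq_fun do rewrite expr0; exact: all_moments_cst.
by under eq_fun do rewrite exprS; exact: all_moments_mul.
Qed.

Lemma all_moments_opp f : all_moments f -> all_moments (fun x => - f x).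
Proof.
move=> If; under eq_fun do rewrite -mulN1r.
by apply: all_moments_mul => //; exact: all_moments_cst.
Qed.

Lemma all_moments_sub f g :
  all_moments f -> all_moments g -> all_moments (fun x => f x - g x).
Proof. by move=> If Ig; apply: all_moments_add => //; exact: all_moments_opp. Qed.

Lemma all_moments_sum (n : nat) (f : nat -> T -> R) :
  (forall i, all_moments (f i)) -> all_moments (fun x => \sum_(i < n) f i x).
Proof.
move=> If; elim: n => [|n ih].
  by under eq_fun do rewrite big_ord0; exact: all_moments_cst.
by under eq_fun do rewrite big_ord_recr; exact: all_moments_add.
Qed.

Lemma all_moments_max f g :
  all_moments f -> all_moments g -> all_moments (fun x => Num.max (f x) (g x)).
Proof.
move=> If Ig.
apply: (@all_moments_le _ (fun x => `|f x| + `|g x|)).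
- by apply: measurable_maxr; [case: If|case: Ig].
- by apply: all_moments_add; exact: all_moments_norm.
- move=> x; rewrite [leRHS]ger0_norm ?addr_ge0//.
  by case: (leP (f x) (g x)) => _; rewrite (lerDl,lerDr).
Qed.

Lemma all_moments_min f g :
  all_moments f -> all_moments g -> all_moments (fun x => Num.min (f x) (g x)).
Proof.
move=> If Ig.
apply: (@all_moments_le _ (fun x => `|f x| + `|g x|)).
- by apply: measurable_minr; [case: If|case: Ig].
- by apply: all_moments_add; exact: all_moments_norm.
- move=> x; rewrite [leRHS]ger0_norm ?addr_ge0//.
  by case: (leP (f x) (g x)) => _; rewrite (lerDl,lerDr).
Qed.

Lemma meanD f g : all_moments f -> all_moments g ->
  \int[P]_x (f x + g x) = \int[P]_x f x + \int[P]_x g x.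
Proof.
by move=> If Ig; rewrite RintegralD//; exact: all_moments_integrable.
Qed.

Lemma meanB f g : all_moments f -> all_moments g ->
  \int[P]_x (f x - g x) = \int[P]_x f x - \int[P]_x g x.
Proof.
by move=> If Ig; rewrite RintegralB//; exact: all_moments_integrable.
Qed.

Lemma meanZ (r : R) f : all_moments f ->
  \int[P]_x (r * f x) = r * \int[P]_x f x.
Proof. by move=> If; rewrite RintegralZl//; exact: all_moments_integrable. Qed.

Lemma mean_cst (r : R) : \int[P]_x r = r :> R.
Proof.
rewrite Rintegral_cst//.
by rewrite [X in fine X](_ : _ = 1%E) ?mulr1//; exact: probability_setT.
Qed.

Lemma mean_sum n (f : nat -> T -> R) : (forall k, all_moments (f k)) ->
  \int[P]_x (\sum_(k < n) f k x) = \sum_(k < n) \int[P]_x f k x.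
Proof.
move=> If; elim: n => [|n ih].
  by under eq_Rintegral do rewrite big_ord0; rewrite mean_cst big_ord0.
under eq_Rintegral do rewrite big_ord_recr.
by rewrite meanD ?ih ?big_ord_recr//; apply: all_moments_sum.
Qed.

Lemma le_mean f g : all_moments f -> all_moments g ->
  (forall x, f x <= g x) -> \int[P]_x f x <= \int[P]_x g x.
Proof.
by move=> If Ig fg; apply: le_Rintegral => //; exact: all_moments_integrable.
Qed.

End all_moments.

Ltac all_moments := repeat first
  [ assumption | exact: all_moments_cst | apply: all_moments_exp
  | apply: all_moments_mul | apply: all_moments_sub | apply: all_moments_add
  | apply: all_moments_opp
  | apply: all_moments_max | apply: all_moments_min | apply: all_moments_norm ].

(** * Independence and moments of sums *)

Section independence.
Context d (T : measurableType d) (R : realType) (P : probability T R).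

(** As functions of [E] both sides are finite measures that agree on rectangles, hence everywhere by
    uniqueness of product measures. The event [D] allows later variables to be carried along. *)
Lemma joint_law_restr d1 d2 (T1 : measurableType d1) (T2 : measurableType d2)
    (D : set T) (Y : {mfun T >-> T1}) (Z : {mfun T >-> T2}) :
  measurable D ->
  (forall A B, measurable A -> measurable B ->
    P (Y @^-1` A `&` Z @^-1` B `&` D) = P (Y @^-1` A) * (P (Z @^-1` B) * P D))%E ->
  forall E, measurable E ->
    P ((fun w => (Y w, Z w)) @^-1` E `&` D) =
    ((distribution P Y \x distribution P Z) E * P D)%E.
Proof.
move=> mD H E mE.
have mYZ : measurable_fun setT (fun w => (Y w, Z w)).
  exact: measurable_fun_pair.
have PDE : P D = (fine (P D))%:E by rewrite fineK// fin_num_measure.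
(* The factor [P D] is absorbed into the second marginal, which avoids conditioning on an event that
   may be null. *)
pose r := NngNum (fine_ge0 (measure_ge0 P D)).
pose m2 : {measure set T2 -> \bar R} := mscale r (distribution P Z).
pose mP : {measure set T -> \bar R} := mrestr P mD.
have [m' m'E] : exists m' : {measure set (T1 * T2) -> \bar R},
    forall F, m' F = P ((fun w => (Y w, Z w)) @^-1` F `&` D).
  pose m' : {measure set (T1 * T2) -> \bar R} := pushforward mP (fun w => (Y w, Z w)).
  by exists (m' mYZ).
have m2E B : m2 B = (P D * distribution P Z B)%E by rewrite PDE.
rewrite -m'E.
rewrite -(@product_measure_unique _ _ _ _ _ (distribution P Y) m2 m')//; last first.
  by move=> A B mA mB; rewrite m'E m2E (muleC (P D)); exact: H.
rewrite /product_measure1 [RHS]muleC PDE -ge0_integralZl//.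
- exact: measurable_fun_xsection.
- by rewrite lee_fin fine_ge0.
Qed.

Lemma mean_mul_indep (Y Z : {mfun T >-> R}) :
  (forall A B, measurable A -> measurable B ->
    P (Y @^-1` A `&` Z @^-1` B) = P (Y @^-1` A) * P (Z @^-1` B))%E ->
  all_moments P Y -> all_moments P Z ->
  \int[P]_w (Y w * Z w) = (\int[P]_w Y w) * (\int[P]_w Z w).
Proof.
move=> H IY IZ.
have mYZ : measurable_fun setT (fun w => (Y w, Z w)).
  exact: measurable_fun_pair.
pose m0 : {measure set (R * R) -> \bar R} := pushforward P (fun w => (Y w, Z w)).
pose m' := m0 mYZ.
have mul_meas : measurable_fun setT (fun z : R * R => (z.1 * z.2)%:E).
  by apply/measurable_EFinP; exact: measurable_funM.
have m'E E : measurable E ->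
    m' E = (distribution P Y \x distribution P Z)%E E.
  move=> mE; rewrite -[RHS]mule1 -(@probability_setT _ _ _ P).
  rewrite -joint_law_restr ?setIT// => A B mA mB.
  by rewrite setIT probability_setT mule1 H.
have iYZ : P.-integrable setT (fun w => (Y w * Z w)%:E).
  by apply: all_moments_integrable; exact: all_moments_mul.
(* The integrability needed for Fubini's theorem is transported from [Y * Z] under [P], since the
   joint law [m'] equals the product law. *)
have iprod : (distribution P Y \x distribution P Z)%E.-integrable setT
    (fun z : R * R => (z.1 * z.2)%:E).
  apply/integrableP; split => //.
  have /integrableP[_] : m'.-integrable setT (fun z : R * R => (z.1 * z.2)%:E).
    exact: integrable_pushforward.
  by rewrite (eq_measure_integral (distribution P Y \x distribution P Z)%E)// => E mE _; exact: m'E.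
have iZ : (distribution P Z).-integrable setT EFin.
  apply: integrable_pushforward => //.
  exact: all_moments_integrable IZ.
have iY : (distribution P Y).-integrable setT EFin.
  apply: integrable_pushforward => //.
  exact: all_moments_integrable IY.
have EY : \int[P]_w Y w = \int[distribution P Y]_y y.
  by rewrite /Rintegral integral_distribution//; exact: all_moments_integrable.
have EZ : \int[P]_w Z w = \int[distribution P Z]_y y.
  by rewrite /Rintegral integral_distribution//; exact: all_moments_integrable.
have -> : \int[P]_w (Y w * Z w) = \int[m']_z (z.1 * z.2).
  by rewrite /Rintegral integral_pushforward.
rewrite /Rintegral (eq_measure_integral (distribution P Y \x distribution P Z)%E);
  last by move=> E mE _; exact: m'E.
rewrite -integral12_prod_meas1//= /fubini_F/=.
have -> : (fun y : R => \int[distribution P Z]_z (y * z)%:E)%E =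
    (fun y : R => (y * \int[P]_w Z w)%:E).
  apply/funext => y; under eq_integral do rewrite EFinM.
  rewrite integralZl// EFinM EZ /Rintegral fineK//.
  exact: integrable_fin_num.
rewrite -/(Rintegral _ _ _) RintegralZr// -EY.
by congr (_ * _); rewrite EZ.
Qed.

End independence.

Section iid.
Context d (T : measurableType d) (R : realType) (P : probability T R).
Variable Xs : nat -> {RV P >-> R}.
Hypothesis indep : mutually_independent Xs.

(* [Y], which will be a function of the first [n] variables, is independent of
   all the later ones jointly. *)
Definition indep_future d' (T' : measurableType d') (n : nat) (Y : T -> T') :=
  forall (C : set T') (J : seq nat) (A : nat -> set R), measurable C ->
    uniq J -> (forall i, i \in J -> (n <= i)%N) ->
    (forall i, measurable (A i)) ->
    P (Y @^-1` C `&` \bigcap_(i in [set` J]) Xs i @^-1` A i) =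
    (P (Y @^-1` C) * \prod_(i <- J) P (Xs i @^-1` A i))%E.

Lemma indep_future_cst d' (T' : measurableType d') (y : T') :
  indep_future 0 (fun=> y).
Proof.
move=> C J A mC uJ _ mA; have [yC|yC] := pselect (C y).
  rewrite (_ : _ @^-1` C = setT) ?setTI ?probability_setT ?mul1e; first exact: indep.
  by apply/seteqP; split.
rewrite (_ : _ @^-1` C = set0) ?set0I ?measure0 ?mul0e//.
by apply/seteqP; split.
Qed.

(** Restricted to an event about variables later than [n], the law of [(Y, Xs n)] is the product law
    times the probability of that event. Evaluating it at the preimage of [C] under [F], with and
    without the event, gives the factorisation. *)
Lemma indep_futureS d' (T' : measurableType d') d2 (T2 : measurableType d2)
    n (Y : T -> T') (F : T' * R -> T2) :
  measurable_fun setT Y -> measurable_fun setT F ->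
  indep_future n Y -> indep_future n.+1 (fun w => F (Y w, Xs n w)).
Proof.
move=> mY mF H C J A mC uJ nJ mA.
pose Y' : {mfun T >-> T'} := HB.pack Y (isMeasurableFun.Build _ _ _ _ _ mY).
pose D (J : seq nat) := \bigcap_(i in [set` J]) Xs i @^-1` A i.
have mD K : measurable (D K).
  by apply: fin_bigcap_measurable => // i _; exact: measurable_funPTI.
have mE : measurable (F @^-1` C) by rewrite -[X in measurable X]setTI; exact: mF.
have PD K : uniq K -> P (D K) = (\prod_(i <- K) P (Xs i @^-1` A i))%E.
  by move=> uK; exact: indep.
have nNJ : n \notin J by apply/negP => /nJ; rewrite ltnn.
have HD K : uniq K -> n \notin K -> (forall i, i \in K -> (n < i)%N) ->
  forall A B, measurable A -> measurable B ->
    P (Y' @^-1` A `&` Xs n @^-1` B `&` D K) =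
    (P (Y' @^-1` A) * (P (Xs n @^-1` B) * P (D K)))%E.
  move=> uK nK ltK A1 B mA1 mB.
  (* [A'] puts [B] at index [n], so that the hypothesis on [Y] applies to the list [n :: K]. *)
  pose A' i := if i == n then B else A i.
  have A'K i : i \in K -> A' i = A i.
    by rewrite /A'; case: eqP => // -> nK'; rewrite nK' in nK.
  rewrite PD// [X in _ = (_ * (_ * X))%E](eq_big_seq
    (fun i => P (Xs i @^-1` A' i))) => [|i /A'K -> //].
  have -> : Xs n @^-1` B = Xs n @^-1` A' n by rewrite /A' eqxx.
  rewrite -(big_cons _ _ n K xpredT (fun i => P (Xs i @^-1` A' i))) -H//=.
  - congr (P _); rewrite -setIA; congr (_ `&` _); apply/seteqP; split => [w [wn wK] i|w wK].
      by rewrite /= inE => /predU1P[->//|iK]; rewrite A'K//; exact: wK.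
    split; first by apply: wK; rewrite /= mem_head.
    by move=> i iK; rewrite -A'K//; apply: wK; rewrite /= inE; apply/orP; right.
  - by rewrite nK.
  - by move=> i; rewrite inE => /predU1P[->//|/ltK /ltnW].
  - by move=> i; rewrite /A'; case: ifP.
have := joint_law_restr (mD J) (HD J uJ nNJ nJ) mE.
(* For the empty list the event is the whole space, which gives the unrestricted law of the pair. *)
have := joint_law_restr (mD [::]) (HD [::] erefl erefl _) mE.
have -> : D [::] = setT by rewrite /D set_nil bigcap_set0.
rewrite probability_setT mule1 setIT -PD// => <- //.
Qed.

Lemma mean_mul_future d' (T' : measurableType d') n (Y : T -> T')
    (f : T' -> R) (g : R -> R) :
  indep_future n Y -> measurable_fun setT f -> measurable_fun setT g ->
  all_moments P (fun w => f (Y w)) -> all_moments P (fun w => g (Xs n w)) ->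
  \int[P]_w (f (Y w) * g (Xs n w)) =
  (\int[P]_w f (Y w)) * (\int[P]_w g (Xs n w)).
Proof.
move=> H mf mg If Ig.
pose fY : {mfun T >-> R} :=
  HB.pack (fun w => f (Y w)) (isMeasurableFun.Build _ _ _ _ _ If.1).
pose gX : {mfun T >-> R} :=
  HB.pack (fun w => g (Xs n w)) (isMeasurableFun.Build _ _ _ _ _ Ig.1).
apply: (mean_mul_indep (Y := fY) (Z := gX)) => // A B mA mB.
have mfA : measurable (f @^-1` A) by rewrite -[X in measurable X]setTI; exact: mf.
have mgB : measurable (g @^-1` B) by rewrite -[X in measurable X]setTI; exact: mg.
have := H (f @^-1` A) [:: n] (fun=> g @^-1` B) mfA erefl.
rewrite big_seq1 set_cons1 bigcap_set1 => -> //.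
by move=> i; rewrite inE => /eqP ->.
Qed.

Variable L : probability R R.
Hypothesis law : forall i (A : set R), measurable A -> P (Xs i @^-1` A) = L A.

Lemma integral_law i (f : R -> \bar R) : measurable_fun setT f ->
  (forall x, 0 <= f x)%E -> (\int[P]_w f (Xs i w) = \int[L]_x f x)%E.
Proof.
move=> mf f0; rewrite -[LHS](ge0_integral_distribution _ mf f0).
by apply: eq_measure_integral => A mA _; exact: law.
Qed.

Lemma all_moments_law i (f : R -> R) :
  all_moments L f -> all_moments P (fun w => f (Xs i w)).
Proof.
move=> [mf If]; split; first exact: measurableT_comp.
move=> k; have mfk : measurable_fun setT (fun x => (`|f x| ^+ k)%:E).
  apply/measurable_EFinP; apply: measurable_funX; exact: measurableT_comp.
have /integrableP[_ fin] := If k.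
apply/integrableP; split; first exact: (measurableT_comp mfk).
rewrite (integral_law i (f := fun x => `|(`|f x| ^+ k)%:E|%E))//.
exact: measurableT_comp.
Qed.

Lemma mean_law i (f : R -> R) :
  all_moments L f -> \int[P]_w f (Xs i w) = \int[L]_x f x.
Proof.
move=> If; have mf := If.1.
rewrite /Rintegral -[X in fine X = _](@integral_distribution _ _ _ _ _ P (Xs i)
  (EFin \o f)).
- by congr fine; apply: eq_measure_integral => A mA _; exact: law.
- exact/measurable_EFinP.
- exact: (all_moments_integrable (all_moments_law i If)).
Qed.

Definition Xsum (U : R -> R) n w := \sum_(i < n) U (Xs i w).

Lemma XsumS U n w : Xsum U n.+1 w = Xsum U n w + U (Xs n w).
Proof. exact: big_ord_recr. Qed.

Lemma all_moments_Xsum U n : all_moments L U -> all_moments P (Xsum U n).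
Proof.
move=> IU; apply: (@all_moments_sum _ _ _ P n (fun i w => U (Xs i w))) => i.
exact: all_moments_law.
Qed.

Lemma measurable_Xsum U n : measurable_fun setT U ->
  measurable_fun setT (Xsum U n).
Proof.
by move=> mU; apply: measurable_sum => i; exact: measurableT_comp.
Qed.

(** * Second and mixed fourth moments of centred sums *)

Section moments.
Variables (U V : R -> R).
Hypotheses (IU : all_moments L U) (IV : all_moments L V).

(** The two sums are kept as a pair because mixed moments need them jointly independent of the next
    variable; [F] updates the pair when that variable is added. *)
Lemma indep_future_Xsum n : indep_future n (fun w => (Xsum U n w, Xsum V n w)).
Proof.
elim: n => [|n ih].
  rewrite (_ : (fun _ => _) = fun=> (0, 0)); first exact: indep_future_cst.
  by apply/funext => w; rewrite /Xsum !big_ord0.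
pose F (z : (R * R) * R) := (z.1.1 + U z.2, z.1.2 + V z.2).
have mU : measurable_fun setT (fun z : (R * R) * R => U z.2).
  by apply: measurableT_comp => //; exact: IU.1.
have mV : measurable_fun setT (fun z : (R * R) * R => V z.2).
  by apply: measurableT_comp => //; exact: IV.1.
rewrite (_ : (fun _ => _) = fun w => F ((Xsum U n w, Xsum V n w), Xs n w)).
  apply: indep_futureS => //.
    by apply: measurable_fun_pair; apply: measurable_Xsum; [exact: IU.1|exact: IV.1].
  by apply: measurable_fun_pair; apply: measurable_funD => //;
    apply: measurableT_comp.
by apply/funext => w; rewrite /Xsum !big_ord_recr.
Qed.

Lemma mean_monomial n i j k l :
  \int[P]_w ((Xsum U n w ^+ i * Xsum V n w ^+ j) *
             (U (Xs n w) ^+ k * V (Xs n w) ^+ l)) =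
  (\int[P]_w (Xsum U n w ^+ i * Xsum V n w ^+ j)) *
  (\int[L]_x (U x ^+ k * V x ^+ l)).
Proof.
have IUn := all_moments_Xsum n IU; have IVn := all_moments_Xsum n IV.
have IUX := all_moments_law n IU; have IVX := all_moments_law n IV.
rewrite (@mean_mul_future _ _ n (fun w => (Xsum U n w, Xsum V n w))
  (fun y => y.1 ^+ i * y.2 ^+ j) (fun x => U x ^+ k * V x ^+ l)).
- by rewrite (@mean_law n (fun x => U x ^+ k * V x ^+ l))//; all_moments.
- exact: indep_future_Xsum.
- by apply: measurable_funM; apply: measurable_funX.
- by apply: measurable_funM; apply: measurable_funX; [exact: IU.1|exact: IV.1].
- by rewrite /=; all_moments.
- by rewrite /=; all_moments.
Qed.

Let m n i j := \int[P]_w (Xsum U n w ^+ i * Xsum V n w ^+ j).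
Let M k l := \int[L]_x (U x ^+ k * V x ^+ l).

(** Binomial expansion of both powers, followed by independence of the new summand from the old
    sums, gives a recursion in [n] for all mixed moments. *)
Lemma mean_XsumSS n i j :
  m n.+1 i j = \sum_(k < i.+1) \sum_(l < j.+1)
    ('C(i, k) * 'C(j, l))%:R * (m n (i - k) (j - l) * M k l).
Proof.
have IUn := all_moments_Xsum n IU; have IVn := all_moments_Xsum n IV.
have IUX := all_moments_law n IU; have IVX := all_moments_law n IV.
pose t k l w := ('C(i, k) * 'C(j, l))%:R *
  ((Xsum U n w ^+ (i - k) * Xsum V n w ^+ (j - l)) *
   (U (Xs n w) ^+ k * V (Xs n w) ^+ l)).
have It k l : all_moments P (t k l) by rewrite /t; all_moments.
transitivity (\int[P]_w (\sum_(k < i.+1) \sum_(l < j.+1) t k l w)).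
  rewrite /m; congr Rintegral; apply/funext => w.
  rewrite !XsumS !exprDn big_distrlr/=.
  apply: eq_bigr => k _; apply: eq_bigr => l _.
  by rewrite /t -(mulr_natr _ 'C(i, k)) -(mulr_natr _ 'C(j, l)) natrM; ring.
rewrite (mean_sum _ (f := fun k w => \sum_(l < j.+1) t k l w)); last first.
  by move=> k; exact: (all_moments_sum _ (It k)).
apply: eq_bigr => k _; rewrite (mean_sum _ (f := t k))//.
apply: eq_bigr => l _; rewrite meanZ; last by all_moments.
by rewrite mean_monomial.
Qed.

Hypotheses (U0 : \int[L]_x U x = 0) (V0 : \int[L]_x V x = 0).

Let M00 : M 0 0 = 1.
Proof. by rewrite /M; under eq_Rintegral do rewrite !expr0 mulr1; exact: mean_cst. Qed.

Let M10 : M 1 0 = 0.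
Proof. by rewrite /M; under eq_Rintegral do rewrite expr0 expr1 mulr1. Qed.

Let M01 : M 0 1 = 0.
Proof. by rewrite /M; under eq_Rintegral do rewrite expr0 expr1 mul1r. Qed.

Let m00 n : m n 0 0 = 1.
Proof. by rewrite /m; under eq_Rintegral do rewrite !expr0 mulr1; exact: mean_cst. Qed.

Let m0 i j : (0 < i + j)%N -> m 0 i j = 0.
Proof.
move=> ij; rewrite /m; under eq_Rintegral do rewrite /Xsum !big_ord0 !expr0n -natrM.
rewrite mean_cst; case: i j ij => [|i] [|j]//.
Qed.

Let expand := (m00, M00, M10, M01, big_ord_recl, big_ord0, mulr0, mul0r, mulr1, add0r, addr0).

Let m10 n : m n 1 0 = 0.
Proof.
elim: n => [|n ih]; first exact: m0.
by rewrite mean_XsumSS !expand/= ih !expand.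
Qed.

Let m01 n : m n 0 1 = 0.
Proof.
elim: n => [|n ih]; first exact: m0.
by rewrite mean_XsumSS !expand/= ih !expand.
Qed.

Let m20 n : m n 2 0 = n%:R * M 2 0.
Proof.
elim: n => [|n ih]; first by rewrite m0// mul0r.
rewrite mean_XsumSS !expand/= /bump/= ih !addn0 !bin0 !binn -natr1.
by ring.
Qed.

Let m02 n : m n 0 2 = n%:R * M 0 2.
Proof.
elim: n => [|n ih]; first by rewrite m0// mul0r.
rewrite mean_XsumSS !expand/= /bump/= ih !addn0 !bin0 !binn -natr1.
by ring.
Qed.

Let m11 n : m n 1 1 = n%:R * M 1 1.
Proof.
elim: n => [|n ih]; first by rewrite m0// mul0r.
rewrite mean_XsumSS !expand/= ih !bin0 !binn -natr1.
by rewrite /bump/= !addn0; ring.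
Qed.

(** In the recursion every term containing a first moment vanishes by centring. What remains adds
    [2 n (M 2 0 M 0 2 + 2 (M 1 1)^2) + M 2 2] at each step. *)
Let m22 n : m n 2 2 =
  n%:R * (n%:R - 1) * (M 2 0 * M 0 2 + 2 * M 1 1 ^+ 2) + n%:R * M 2 2.
Proof.
elim: n => [|n ih]; first by rewrite m0// !mul0r addr0.
rewrite mean_XsumSS !expand/= /bump/= ?addn0 ?addn1.
rewrite (ih : m n (2 - 0) (2 - 0) = _) (m20 n : m n (2 - 0) (2 - 2) = _).
rewrite (m11 n : m n (2 - 1) (2 - 1) = _) (m10 n : m n (2 - 1) (2 - 2) = _).
rewrite (m02 n : m n (2 - 2) (2 - 0) = _) (m01 n : m n (2 - 2) (2 - 1) = _).
rewrite !bin0 !bin1 !binn -natr1 !mul0r !mulr0 !add0r addr0.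
by ring.
Qed.

Lemma mean_Xsum_sqr n : \int[P]_w (Xsum U n w ^+ 2) = n%:R * \int[L]_x (U x ^+ 2).
Proof.
have := m20 n; rewrite /m /M; under eq_Rintegral do rewrite expr0 mulr1.
by move=> ->; congr (_ * _); apply: eq_Rintegral => x _; rewrite expr0 mulr1.
Qed.

Lemma mean_Xsum_sqr_mul n :
  \int[P]_w (Xsum U n w ^+ 2 * Xsum V n w ^+ 2) =
  n%:R * (n%:R - 1) *
    ((\int[L]_x (U x ^+ 2)) * (\int[L]_x (V x ^+ 2)) +
     2 * (\int[L]_x (U x * V x)) ^+ 2) +
  n%:R * (\int[L]_x (U x ^+ 2 * V x ^+ 2)).
Proof.
rewrite [LHS](m22 n) /M; congr (_ * (_ * _ + _) + _).
- by apply: eq_Rintegral => x _; rewrite expr0 mulr1.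
- by apply: eq_Rintegral => x _; rewrite expr0 mul1r.
Qed.

End moments.
End iid.

(** * Bisection *)

Section real_inequalities.
Variable R : realFieldType.
Implicit Types a b x y : R.

(** This is [2ab <= a^2 / 5 + 5 b^2]. The coefficient of [a^2] is kept close to 1 so that
    [(6/5)^3 / 2 < 1], which makes the bisection contract. *)
Lemma sqr_add_le a b : (a + b) ^+ 2 <= 6 / 5 * a ^+ 2 + 6 * b ^+ 2.
Proof. have := sqr_ge0 (a - 5 * b); nra. Qed.

Lemma exp4_add_le a b : 0 <= a -> 0 <= b ->
  (a + b) ^+ 4 <= (6 / 5) ^+ 3 * a ^+ 4 + 6 ^+ 3 * b ^+ 4.
Proof.
move=> a0 b0; have h := sqr_add_le a b.
have h2 := sqr_add_le (6 / 5 * a ^+ 2) (6 * b ^+ 2).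
rewrite (exprM (a + b) 2 2) (exprM a 2 2) (exprM b 2 2).
apply: le_trans (_ : (6 / 5 * a ^+ 2 + 6 * b ^+ 2) ^+ 2 <= _).
  rewrite lerXn2r ?nnegrE ?sqr_ge0//.
  by rewrite addr_ge0// mulr_ge0// sqr_ge0.
apply: le_trans h2 _; lra.
Qed.

Lemma exp4_max_le a b : Num.max a b ^+ 4 <= a ^+ 4 + b ^+ 4.
Proof.
have p x : 0 <= x ^+ 4 by rewrite (exprM x 2 2) sqr_ge0.
by case: (leP a b) => _; [rewrite lerDr|rewrite lerDl]; exact: p.
Qed.

Lemma exp4_min_le x y : Num.min `|x| `|y| ^+ 4 <= x ^+ 2 * y ^+ 2.
Proof.
rewrite -(real_normK (num_real x)) -(real_normK (num_real y)).
have := normr_ge0 x; have := normr_ge0 y.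
rewrite (exprM _ 2 2) (expr2 (_ ^+ 2)).
by case: (leP `|x| `|y|) => xy y0 x0; apply: ler_pM; rewrite ?sqr_ge0//
  lerXn2r ?nnegrE// ltW.
Qed.

(** One bisection step: [a] and [b] are the bounds on the two halves and get the small factor, [c]
    and [e] are the corrections and get [12^3 = 8 . 6^3]. *)
Lemma exp4_chain_le a b c e : 0 <= a -> 0 <= b -> 0 <= c -> 0 <= e ->
  (Num.max a b + (c + e)) ^+ 4 <=
  (6 / 5) ^+ 3 * (a ^+ 4 + b ^+ 4) + 12 ^+ 3 * (c ^+ 4 + e ^+ 4).
Proof.
move=> a0 b0 c0 e0.
have m0 : 0 <= Num.max a b by rewrite le_max a0.
have h1 := exp4_add_le m0 (addr_ge0 c0 e0).
have h2 := exp4_max_le a b.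
have h3 : (c + e) ^+ 4 <= 8 * (c ^+ 4 + e ^+ 4).
  have k x y : (x + y) ^+ 2 <= 2 * (x ^+ 2 + y ^+ 2) :> R.
    have := sqr_ge0 (x - y); nra.
  have k1 := k c e; have k2 := k (c ^+ 2) (e ^+ 2).
  rewrite (exprM (c + e) 2 2) (exprM c 2 2) (exprM e 2 2).
  apply: le_trans (_ : (2 * (c ^+ 2 + e ^+ 2)) ^+ 2 <= _); last by nra.
  by rewrite lerXn2r ?nnegrE ?sqr_ge0// mulr_ge0// addr_ge0// sqr_ge0.
lra.
Qed.

(** Read [y] and [z] as the values at the two ends of an interval and [t] as the value at a division
    point: moving the right end from [z] to [t] costs at most the second minimum. When [|t - x|] is
    the smaller distance in the first minimum on the right, the two distances on the left exceed it
    by at most [|t - y|] and [|z - t|] respectively. *)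
Lemma min_dist_left x y z t :
  Num.min `|x - y| `|z - x| <=
  Num.min `|x - y| `|t - x| + Num.min `|t - y| `|z - t|.
Proof.
have e1 : x - y = (t - y) - (t - x) by ring.
have e2 : z - x = (z - t) + (t - x) by ring.
have := ler_normB (t - y) (t - x); rewrite -e1.
have := ler_normD (z - t) (t - x); rewrite -e2.
have := normr_ge0 (z - t); have := normr_ge0 (t - y).
rewrite !minElt; do 3 case: ifPn; rewrite -?leNgt; lra.
Qed.

(** The mirror image, with the two ends exchanged: here the left end moves to [t]. *)
Lemma min_dist_right x y z t :
  Num.min `|x - y| `|z - x| <=
  Num.min `|x - t| `|z - x| + Num.min `|t - y| `|z - t|.
Proof.
have := min_dist_left x z y t.
by rewrite !(distrC _ z, distrC y) (minC `|z - x|) (minC `|z - x|)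
  (minC `|z - t|) (distrC t x).
Qed.

End real_inequalities.

(** * Maximal inequality for a chain whose cross moments are controlled by a mass [mu] *)

Section maximal_inequality.
Context d (T : measurableType d) (R : realType) (P : probability T R).
Variables (S : nat -> T -> R) (mu : nat -> R) (C : R).
Hypotheses (IS : forall k, all_moments P (S k)) (C0 : 0 <= C).
Hypothesis mu_mono : {homo mu : i j / (i <= j)%N >-> i <= j}.
Hypothesis S_cross : forall i j k, (i <= j <= k)%N ->
  \int[P]_w ((S j w - S i w) ^+ 2 * (S k w - S j w) ^+ 2)
    <= C * ((mu j - mu i) * (mu k - mu j)).

Lemma mean_min4 i j k : (i <= j <= k)%N ->
  \int[P]_w (Num.min `|S j w - S i w| `|S k w - S j w| ^+ 4)
    <= C * (mu k - mu i) ^+ 2.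
Proof.
move=> ijk; have /andP[ij jk] := ijk.
apply: (le_trans _ (le_trans (S_cross ijk) _)).
  by apply: le_mean => [||w]; [all_moments|all_moments|exact: exp4_min_le].
rewrite ler_wpM2l// expr2.
have := mu_mono ij; have := mu_mono jk => h1 h2.
by rewrite ler_pM ?subr_ge0//; lra.
Qed.

(** [h] is the first index at which half of the mass is reached. The cell between [h - 1] and [h]
    may carry most of the mass, as at an atom, and is therefore left out of both halves. *)
Lemma mu_split i j : (i < j)%N -> exists h, [/\ (i < h <= j)%N,
  mu h.-1 - mu i <= (mu j - mu i) / 2 & mu j - mu h <= (mu j - mu i) / 2].
Proof.
move=> ij; have mij := mu_mono (ltnW ij).
have ex : exists h, (i < h)%N && ((mu j - mu i) / 2 <= mu h - mu i).
  by exists j; rewrite ij /=; lra.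
case: (ex_minnP ex) => h /andP[ih mh] hmin.
have hj : (h <= j)%N by apply: hmin; rewrite ij /=; lra.
exists h; split; [by rewrite ih| |by lra].
have [e|ne] := eqVneq h.-1 i; first by rewrite e; lra.
rewrite leNgt; apply/negP => lt.
have : (h <= h.-1)%N by apply: hmin; rewrite (ltW lt) andbT; lia.
by lia.
Qed.

(* Bisection at the [mu]-median [h] of [[i, j]]: the bound for [[i, j]] is the
   maximum of those for [[i, h - 1]] and [[h, j]] plus two correction terms. Each
   half carries at most half of the mass, so the fourth moments of both bounds add
   up to a factor [2 / 4 * (6 / 5) ^+ 3 < 1] of the target. *)
Lemma min_dist_bound N i j : (i <= j)%N -> (j - i <= N)%N ->
  exists B : T -> R, [/\ all_moments P B, forall w, 0 <= B w,
    forall k w, (i <= k <= j)%N ->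
      Num.min `|S k w - S i w| `|S j w - S k w| <= B w &
    \int[P]_w (B w ^+ 4) <= 13 ^+ 4 * (C * (mu j - mu i) ^+ 2)].
Proof.
elim: N i j => [|N ih] i j ij jiN.
  have -> : j = i by lia.
  exists (fun=> 0); split => //; first exact: all_moments_cst.
    move=> k w /andP[ik ki]; have -> : k = i by lia.
    by rewrite subrr normr0 minxx.
  by rewrite subrr !expr0n !mulr0 mean_cst.
have [->|ltij] := eqVneq i j; first by apply: ih => //; rewrite subnn.
have {ltij}ltij : (i < j)%N by rewrite ltn_neqAle ltij.
have [h [/andP[ih1 hj] hl hr]] := mu_split ltij.
have ih1' : (i <= h.-1)%N by lia.
have [||B1 [IB1 B10 B1S B1m]] := ih i h.-1; [lia|lia|].
have [||B2 [IB2 B20 B2S B2m]] := ih h j; [lia|lia|].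
pose m1 w := Num.min `|S h.-1 w - S i w| `|S j w - S h.-1 w|.
pose m2 w := Num.min `|S h w - S h.-1 w| `|S j w - S h w|.
have Im1 : all_moments P m1 by rewrite /m1; all_moments.
have Im2 : all_moments P m2 by rewrite /m2; all_moments.
have m10 w : 0 <= m1 w by rewrite le_min !normr_ge0.
have m20 w : 0 <= m2 w by rewrite le_min !normr_ge0.
exists (fun w => Num.max (B1 w) (B2 w) + (m1 w + m2 w)); split.
- by all_moments.
- by move=> w; rewrite !addr_ge0// le_max B10.
- move=> k w /andP[ik kj]; have [kh|hk] := leqP k h.-1.
    apply: le_trans (min_dist_left _ _ _ (S h.-1 w)) _; rewrite -/(m1 w).
    have := B1S k w; rewrite ik kh => /(_ isT) b.
    have : B1 w <= Num.max (B1 w) (B2 w) by rewrite le_max lexx.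
    have := m20 w; lra.
  (* For [k] in the right half the left end moves twice: from [i] to [h - 1] at cost [m1], then from
     [h - 1] to [h] at cost [m2]. *)
  apply: le_trans (min_dist_right _ _ _ (S h.-1 w)) _; rewrite -/(m1 w).
  have := min_dist_right (S k w) (S h.-1 w) (S j w) (S h w); rewrite -/(m2 w).
  have := B2S k w; rewrite kj andbT => /(_ ltac:(lia)) b.
  have : B2 w <= Num.max (B1 w) (B2 w) by rewrite le_max lexx orbT.
  lra.
have K1 : \int[P]_w (m1 w ^+ 4) <= C * (mu j - mu i) ^+ 2.
  by apply: mean_min4; rewrite ih1'; lia.
have K2 : \int[P]_w (m2 w ^+ 4) <= C * (mu j - mu h.-1) ^+ 2.
  by apply: mean_min4; lia.
have mu1 := mu_mono ih1'; have mu2 := mu_mono hj.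
have mu3 : mu h.-1 <= mu h := mu_mono (leq_pred h).
apply: le_trans (_ : \int[P]_w ((6 / 5) ^+ 3 * (B1 w ^+ 4 + B2 w ^+ 4)
    + 12 ^+ 3 * (m1 w ^+ 4 + m2 w ^+ 4)) <= _).
  apply: le_mean => [||w]; [by all_moments|by all_moments|].
  exact: exp4_chain_le.
rewrite meanD; [|by all_moments|by all_moments].
rewrite !meanZ; [|by all_moments|by all_moments].
rewrite !meanD; [|by all_moments..].
set D := C * (mu j - mu i) ^+ 2.
have D0 : 0 <= D by rewrite mulr_ge0// sqr_ge0.
have half x : 0 <= x -> x <= (mu j - mu i) / 2 -> C * x ^+ 2 <= D / 4.
  move=> x0 xy; rewrite /D -mulrA ler_wpM2l//.
  rewrite (_ : _ / 4 = ((mu j - mu i) / 2) ^+ 2); last by field.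
  by rewrite lerXn2r ?nnegrE//; exact: le_trans xy.
have s1 := half _ _ hl; have s2 := half _ _ hr.
rewrite !subr_ge0 in s1 s2.
have {}s1 := s1 mu1; have {}s2 := s2 mu2.
have s3 : C * (mu j - mu h.-1) ^+ 2 <= D.
  by rewrite ler_wpM2l// lerXn2r ?nnegrE; lra.
rewrite -/D in K1.
(* The halves contribute [(6/5)^3 / 2 = 0.864] times [13^4 D] and the corrections
   [2 . 12^3 D = 3456 D], which is less than the remaining [0.136] times [13^4 D]. *)
lra.
Qed.

(** Going to the nearer of the two ends [S 0] and [S m] bounds [|S k|] by the bisection bound plus
    [|S 0| + |S m|]. *)
Lemma chained_maximal_inequality m (tau : R) : 0 < tau ->
  C * (mu m - mu 0) ^+ 2 <= 5 * tau ^+ 2 ->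
  \int[P]_w (S 0 w ^+ 2) <= tau -> \int[P]_w (S m w ^+ 2) <= tau ->
  exists D : T -> R, [/\ all_moments P D, forall w, 0 <= D w,
    forall k w, (k <= m)%N -> `|S k w| <= D w &
    \int[P]_w (D w ^+ 2) <= 22 ^+ 4 * tau].
Proof.
move=> tau0 Ctau S0tau Smtau.
have [B [IB B0 BS Bm]] := min_dist_bound (leq0n m) (leqnn _).
exists (fun w => B w + (`|S 0 w| + `|S m w|)); split.
- by all_moments.
- by move=> w; rewrite !addr_ge0.
- move=> k w km; have := BS k w; rewrite km => /(_ isT).
  have := ler_distD (S 0 w) (S k w) 0; rewrite !subr0.
  have := ler_distD (S m w) (S k w) 0; rewrite !subr0 (distrC (S k w)).
  have := normr_ge0 (S 0 w); have := normr_ge0 (S m w).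
  rewrite minElt; case: ifP; lra.
apply: le_trans (_ : \int[P]_w ((3 / 2 / tau) * B w ^+ 4 + (3 / 2 * tau +
    (3 * S 0 w ^+ 2 + 3 * S m w ^+ 2))) <= _).
  apply: le_mean => [||w]; [by all_moments|by all_moments|].
  rewrite -(real_normK (num_real (S 0 w))) -(real_normK (num_real (S m w))).
  move: (B w) `|S 0 w| `|S m w| => b x y.
  (* AM-GM with the scale [tau] *)
  have h : 3 * b ^+ 2 <= 3 / 2 / tau * b ^+ 4 + 3 / 2 * tau.
    rewrite -(ler_pM2r tau0).
    rewrite (_ : (_ + _) * tau = 3 / 2 * ((b ^+ 2) ^+ 2 + tau ^+ 2)); last first.
      by field; rewrite gt_eqF.
    have := sqr_ge0 (b ^+ 2 - tau); nra.
  have := sqr_ge0 (b - x); have := sqr_ge0 (b - y); have := sqr_ge0 (x - y).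
  nra.
rewrite meanD; [|by all_moments|by all_moments].
rewrite meanD; [|by all_moments|by all_moments].
rewrite meanD; [|by all_moments|by all_moments].
rewrite !meanZ; [|by all_moments..].
rewrite mean_cst.
have : 3 / 2 / tau * \int[P]_w (B w ^+ 4) <= 3 / 2 * 13 ^+ 4 * 5 * tau.
  rewrite -(ler_pM2r tau0).
  rewrite (_ : 3 / 2 / tau * _ * tau = 3 / 2 * \int[P]_w (B w ^+ 4)); last first.
    by field; rewrite gt_eqF.
  move: Bm Ctau; set D := C * _; set I := Rintegral _ _ _; rewrite expr2.
  move=> h1 h2; lra.
(* The total is [3/2 . 5 . 13^4 + 15/2], which is below [22^4]. *)
lra.
Qed.
End maximal_inequality.

(** * The weighted empirical process *)

(** The left side is the mixed fourth moment of two centred sums when the uncentred summands have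
    product zero, means [p], [q] and second moments [a], [b]. Of the constant 5, the terms with
    distinct indices account for 3 and the diagonal ones for 2. *)
Lemma cross_moment_le (R : realFieldType) (n : nat) (a b p q : R) :
  p ^+ 2 <= a -> q ^+ 2 <= b ->
  n%:R * (n%:R - 1) *
    ((a - p ^+ 2) * (b - q ^+ 2) + 2 * (- (p * q)) ^+ 2) +
  n%:R * (q ^+ 2 * a + p ^+ 2 * b - 3 * (p ^+ 2 * q ^+ 2)) <=
  5 * ((n%:R * a) * (n%:R * b)).
Proof.
rewrite sqrrN exprMn.
move: (sqr_ge0 p) (sqr_ge0 q); move: (p ^+ 2) (q ^+ 2) => u v u0 v0 ua vb.
have uv : u * v <= a * b by rewrite ler_pM.
have uv0 : 0 <= u * v by rewrite mulr_ge0.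
have vu : v * a <= a * b by rewrite mulrC ler_wpM2l//; lra.
have bu : u * b <= a * b by rewrite ler_wpM2r//; lra.
case: n => [|n]; first by rewrite !mul0r mulr0 addr0.
have n1 : 1 <= n.+1%:R :> R by rewrite ler1n.
move: n.+1%:R n1 => N N1.
have x0 : (a - u) * (b - v) + 2 * (u * v) <= 3 * (a * b) by nra.
have x1 : N * (N - 1) * ((a - u) * (b - v) + 2 * (u * v)) <=
    N * N * (3 * (a * b)).
  apply: ler_pM => //; [by rewrite mulr_ge0; lra|by nra|].
  by rewrite ler_wpM2l; lra.
have x2 : N * (v * a + u * b - 3 * (u * v)) <= N * (2 * (a * b)).
  by rewrite ler_wpM2l; lra.
have x3 : N * (2 * (a * b)) <= N * N * (2 * (a * b)).
  by rewrite ler_wpM2r; nra.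
rewrite (_ : N * a * (N * b) = N * N * (a * b)); last by ring.
lra.
Qed.

Section weighted_process.
Context d (T : measurableType d) (R : realType) (P : probability T R).
Variable Xs : nat -> {RV P >-> R}.
Hypothesis indep : mutually_independent Xs.
Variable L : probability R R.
Hypothesis law : forall i (A : set R), measurable A -> P (Xs i @^-1` A) = L A.

Definition centered (G : R -> R) (x : R) := G x - \int[L]_y G y.

Lemma all_moments_centered G : all_moments L G -> all_moments L (centered G).
Proof. by rewrite /centered => IG; all_moments. Qed.

Lemma mean_centered G : all_moments L G -> \int[L]_x centered G x = 0.
Proof.
move=> IG; rewrite /centered meanB; [|by all_moments|by all_moments].
by rewrite mean_cst subrr.
Qed.

Lemma mean_centered_sqr G : all_moments L G ->
  \int[L]_x (centered G x ^+ 2) =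
  \int[L]_x (G x ^+ 2) - (\int[L]_x G x) ^+ 2.
Proof.
move=> IG; rewrite /centered; set p := Rintegral L _ G.
transitivity (\int[L]_x (G x ^+ 2 + ((- 2 * p) * G x + p ^+ 2))).
  by apply: eq_Rintegral => x _; ring.
rewrite meanD; [|by all_moments|by all_moments].
rewrite meanD; [|by all_moments|by all_moments].
rewrite meanZ; [|by all_moments]; rewrite mean_cst -/p; ring.
Qed.

Lemma sqr_mean_le G : all_moments L G ->
  (\int[L]_x G x) ^+ 2 <= \int[L]_x (G x ^+ 2).
Proof.
move=> IG; rewrite -subr_ge0 -mean_centered_sqr//.
by apply: Rintegral_ge0 => x _; exact: sqr_ge0.
Qed.

Lemma mean_Xsum_centered_sqr_le G n : all_moments L G ->
  \int[P]_w (Xsum Xs (centered G) n w ^+ 2) <= n%:R * \int[L]_x (G x ^+ 2).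
Proof.
move=> IG; have Ic := all_moments_centered IG.
rewrite (mean_Xsum_sqr indep law Ic Ic (mean_centered IG)).
rewrite ler_wpM2l// mean_centered_sqr// gerBl sqr_ge0//.
Qed.

(** Because [G H = 0], the covariance is minus the product of the means, and the mixed fourth moment
    of the centred functions involves only means and second moments. *)
Lemma mean_Xsum_centered_cross_le G H n : all_moments L G -> all_moments L H ->
  (forall x, G x * H x = 0) ->
  \int[P]_w (Xsum Xs (centered G) n w ^+ 2 * Xsum Xs (centered H) n w ^+ 2)
  <= 5 * ((n%:R * \int[L]_x (G x ^+ 2)) * (n%:R * \int[L]_x (H x ^+ 2))).
Proof.
move=> IG IH GH; have IcG := all_moments_centered IG.
have IcH := all_moments_centered IH.
rewrite (mean_Xsum_sqr_mul indep law IcG IcH (mean_centered IG) (mean_centered IH)).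
apply: le_trans (cross_moment_le _ (sqr_mean_le IG) (sqr_mean_le IH)).
rewrite !mean_centered_sqr//.
set p := Rintegral L _ G; set q := Rintegral L _ H.
have -> : \int[L]_x (centered G x * centered H x) = - (p * q).
  transitivity (\int[L]_x ((- q) * G x + ((- p) * H x + p * q))).
    apply: eq_Rintegral => x _; rewrite /centered -/p -/q.
    have := GH x; nra.
  rewrite meanD; [|by all_moments|by all_moments].
  rewrite meanD; [|by all_moments|by all_moments].
  rewrite !meanZ; [|by all_moments..]. rewrite mean_cst -/p -/q; ring.
have -> : \int[L]_x (centered G x ^+ 2 * centered H x ^+ 2) =
    q ^+ 2 * (\int[L]_x (G x ^+ 2)) + p ^+ 2 * (\int[L]_x (H x ^+ 2)) -
    3 * (p ^+ 2 * q ^+ 2).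
  transitivity (\int[L]_x (q ^+ 2 * G x ^+ 2 + (p ^+ 2 * H x ^+ 2 +
      ((- 2 * p * q ^+ 2) * G x + ((- 2 * q * p ^+ 2) * H x + p ^+ 2 * q ^+ 2))))).
    apply: eq_Rintegral => x _; rewrite /centered -/p -/q.
    have := GH x; move: (G x) (H x) => a b ab.
    (* The terms containing the factor [a * b = 0] are separated from the surviving ones. *)
    rewrite (_ : (a - p) ^+ 2 * (b - q) ^+ 2 = (a * b) ^+ 2
       - 2 * q * a * (a * b) - 2 * p * b * (a * b) + 4 * p * q * (a * b)
       + (q ^+ 2 * a ^+ 2 + (p ^+ 2 * b ^+ 2 +
      ((- 2 * p * q ^+ 2) * a + ((- 2 * q * p ^+ 2) * b + p ^+ 2 * q ^+ 2)))));
      last by ring.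
    by rewrite ab expr0n/= !mulr0; ring.
  rewrite !meanD; [|by all_moments..].
  rewrite !meanZ; [|by all_moments..].
  rewrite mean_cst -/p -/q; ring.
exact: lexx.
Qed.

Variables (f : R -> R) (e : nat -> set R).
Hypotheses (If : all_moments L f) (me : forall k, measurable (e k)).
Hypothesis e_mono : forall i j, (i <= j)%N -> e i `<=` e j.

(* [f] truncated to the cell [e k], which will be [x <= x_k]. The last [e m] is the
   full set, so that the total weight belongs to the same process. *)
Definition truncated k x : R := f x * \1_(e k) x.

Lemma all_moments_truncated k : all_moments L (truncated k).
Proof.
apply: (@all_moments_le _ _ _ _ _ f) => //.
  by apply: measurable_funM; [exact: If.1|exact: measurable_indic].
by move=> x; rewrite /truncated indicE; case: (_ \in _);
  rewrite ?mulr1// mulr0 normr0.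
Qed.

Let nu k := \int[L]_x (truncated k x ^+ 2).

Lemma indic_subset i j x : (i <= j)%N ->
  (\1_(e i) x : R) * \1_(e j) x = \1_(e i) x.
Proof.
move=> ij; rewrite !indicE; have [xi|xi] := boolP (x \in e i); last by rewrite mul0r.
by rewrite mem_set ?mulr1//; apply: (e_mono ij); exact: set_mem.
Qed.

Lemma indic_sqr i x : (\1_(e i) x : R) ^+ 2 = \1_(e i) x.
Proof. by rewrite expr2 indic_subset. Qed.

(** The cells are nested, so the difference of their indicators is again an indicator and equals its
    own square. *)
Lemma mean_truncatedB_sqr i j : (i <= j)%N ->
  \int[L]_x ((truncated j x - truncated i x) ^+ 2) = nu j - nu i.
Proof.
move=> ij; have Ij := all_moments_truncated j; have Ii := all_moments_truncated i.
rewrite /nu -meanB; [|by all_moments|by all_moments].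
apply: eq_Rintegral => x _; rewrite /truncated.
have := indic_subset x ij; have := indic_sqr i x.
move: (\1_(e i) x : R) (\1_(e j) x : R) (f x) => a b c aa ab.
rewrite -mulrBr !exprMn sqrrB (mulrC b) ab aa; ring.
Qed.

Lemma nu_mono : {homo nu : i j / (i <= j)%N >-> i <= j}.
Proof.
move=> i j ij; rewrite -subr_ge0 -mean_truncatedB_sqr//.
by apply: Rintegral_ge0 => x _; exact: sqr_ge0.
Qed.

Lemma Xsum_centeredB G H n w : all_moments L G -> all_moments L H ->
  Xsum Xs (centered G) n w - Xsum Xs (centered H) n w =
  Xsum Xs (centered (fun x => G x - H x)) n w.
Proof.
move=> IG IH; rewrite /Xsum -sumrB; apply: eq_bigr => i _.
by rewrite /centered meanB//; ring.
Qed.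

(** The chained inequality with mass [n nu] and scale [tau = n E f^2]; the resulting bound depends
    neither on the cells nor on their number. *)
Lemma weighted_maximal_inequality n m : (0 < n)%N -> 0 < \int[L]_x (f x ^+ 2) ->
  exists D : T -> R, [/\ all_moments P D, forall w, 0 <= D w,
    forall k w, (k <= m)%N -> `|Xsum Xs (centered (truncated k)) n w| <= D w &
    \int[P]_w (D w ^+ 2) <= 22 ^+ 4 * (n%:R * \int[L]_x (f x ^+ 2))].
Proof.
move=> n0 f0; have It := all_moments_truncated.
have nu_le k : nu k <= \int[L]_x (f x ^+ 2).
  have Ik := It k.
  apply: le_mean => [||x]; [by all_moments|by all_moments|].
  rewrite /truncated exprMn indic_sqr; apply: ler_piMr; first exact: sqr_ge0.
  by have /andP[] := @indic_le1 R (e k) x.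
have nu0 k : 0 <= nu k by apply: Rintegral_ge0 => x _; exact: sqr_ge0.
apply: (@chained_maximal_inequality _ _ _ _ (fun k => Xsum Xs (centered (truncated k)) n)
  (fun k => n%:R * nu k) 5) => //.
- by move=> k; apply: (all_moments_Xsum law); exact: all_moments_centered.
- by move=> i j ij; rewrite ler_wpM2l// nu_mono.
- move=> i j k /andP[ij jk].
  under eq_Rintegral do rewrite !Xsum_centeredB//.
  have Iij := all_moments_sub (It j) (It i).
  have Ijk := all_moments_sub (It k) (It j).
  (* Consecutive increments are [f] restricted to disjoint sets, so their product is zero. *)
  apply: le_trans (mean_Xsum_centered_cross_le _ Iij Ijk _) _.
    move=> x; rewrite /truncated -!mulrBr.
    rewrite mulrACA (_ : (_ - _) * (_ - _) = 0) ?mulr0//.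
    rewrite mulrBl !mulrBr !indic_subset ?(leq_trans ij)//.
    by rewrite !subrr.
  by rewrite !mean_truncatedB_sqr// !mulrBr.
- by rewrite mulr_gt0// ltr0n.
- rewrite ler_pM2l// -mulrBr.
  have := nu_le m; have := nu0 m; have := nu0 0; have := nu_mono (leq0n m).
  move=> h1 h2 h3 h4; rewrite lerXn2r ?nnegrE// ?mulr_ge0 ?ler_wpM2l// ?subr_ge0//; lra.
- apply: le_trans (mean_Xsum_centered_sqr_le _ (It 0)) _.
  by rewrite ler_wpM2l//; exact: (nu_le 0).
- apply: le_trans (mean_Xsum_centered_sqr_le _ (It m)) _.
  by rewrite ler_wpM2l//; exact: (nu_le m).
Qed.

End weighted_process.

(** * Tilted laws *)

Section tilted_law.
Context d0 (T0 : measurableType d0) (R : realType) (Q : probability T0 R).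
Variables (X : {RV Q >-> R}) (g : {mfun R >-> R}).
Hypothesis finite_mgf : forall eta : R, 0 < eta ->
    ('E_Q[(fun w => expR (eta * g (X w)))%R] < +oo)%E.
Hypothesis g_pos : (0 < Q [set w | 0 < g (X w)]%R)%E.
Variable theta : R.
Hypothesis theta0 : 0 < theta.

Let L : probability R R := distribution Q X.
Let c := fine 'E_Q[fun w => expR (theta * g (X w))].

Lemma measurable_expR_tilt (eta : R) :
  measurable_fun setT (fun x => expR (eta * g x)).
Proof. by apply: measurableT_comp => //; exact: measurable_funM. Qed.

Lemma all_moments_expR_tilt : all_moments L (fun x => expR (theta * g x)).
Proof.
split; first exact: measurable_expR_tilt.
move=> k; apply/integrableP; split.
  apply/measurable_EFinP; apply: measurable_funX; apply: measurableT_comp => //.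
  exact: measurable_expR_tilt.
(* The [k]-th moment is the exponential moment at [k theta]; order zero is separate because only
   positive exponents are covered by [finite_mgf]. *)
have [->|k0] := posnP k.
  by have /integrableP[_] := (all_moments_cst L 1).2 0%N.
have kt : 0 < k%:R * theta by rewrite mulr_gt0// ltr0n.
under eq_integral do rewrite abse_EFin normrX normr_id gtr0_norm ?expR_gt0//
  -expRM_natl mulrA.
have := finite_mgf kt; rewrite unlock.
rewrite -(@ge0_integral_distribution _ _ _ _ _ Q X
   (fun x => (expR (k%:R * theta * g x))%:E))//.
by apply/measurable_EFinP; exact: measurable_expR_tilt.
Qed.

Lemma mean_distribution (f : R -> R) : all_moments L f ->
  fine 'E_Q[fun w => f (X w)] = \int[L]_x f x.
Proof.
move=> If; have mf := If.1; rewrite unlock /Rintegral /L.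
(* [X] is viewed as a constant sequence in order to reuse the transfer of moments from [L]. *)
have lawX i (A : set R) : measurable A -> Q ((fun _ : nat => X) i @^-1` A) = L A.
  by [].
have IX := all_moments_law lawX 0 If.
rewrite -[X in _ = fine X]/(integral (distribution Q X) setT (EFin \o f)).
rewrite integral_distribution//; first exact/measurable_EFinP.
exact: all_moments_integrable IX.
Qed.

(** The tilt is at least 1 where [g] is positive, so [c] is at least the probability of that
    event. *)
Lemma mean_expR_tilt_gt0 : 0 < c.
Proof.
pose A := [set x : R | 0 < g x].
have mA : measurable A.
  by rewrite [A](_ : _ = g @^-1` `]0, +oo[); [exact: measurable_funPTI|
    apply/seteqP; split => x; rewrite /A/= in_itv/= andbT].
have Ie := all_moments_expR_tilt.
have I1 : all_moments L (\1_A).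
  apply: (all_moments_le _ (all_moments_cst L 1)); first exact: measurable_indic.
  by move=> x; rewrite normr1 indicE; case: (_ \in _); rewrite ?normr1 ?normr0.
rewrite /c (mean_distribution Ie).
apply: (@lt_le_trans _ _ (\int[L]_x \1_A x)).
  rewrite /Rintegral integral_indic// setIT fine_gt0//.
  by rewrite (le_lt_trans (probability_le1 _ mA)) ?ltry// andbT; exact: g_pos.
apply: le_mean => // x; rewrite indicE.
have [|_] := boolP (x \in A); last exact: expR_ge0.
by rewrite inE /A/= => gx; rewrite -expR0 ler_expR mulr_ge0// ltW.
Qed.

(** The density of the tilted law with respect to [L]; its second moment is [tilted_M]. *)
Definition weight x := expR (theta * g x) / c.

Lemma all_moments_weight : all_moments L weight.
Proof.
by apply: all_moments_mul; [exact: all_moments_expR_tilt|exact: all_moments_cst].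
Qed.

Lemma mean_weight : \int[L]_x weight x = 1.
Proof.
under eq_Rintegral do rewrite /weight mulrC.
rewrite meanZ; last exact: all_moments_expR_tilt.
rewrite -(mean_distribution all_moments_expR_tilt) -/c mulVf//.
by rewrite gt_eqF// mean_expR_tilt_gt0.
Qed.

Lemma mean_weight_sqr : \int[L]_x (weight x ^+ 2) = tilted_M X g theta.
Proof.
have Ie := all_moments_expR_tilt.
under eq_Rintegral do rewrite /weight expr_div_n mulrC.
rewrite meanZ; last by all_moments.
rewrite -(@mean_distribution (fun x => expR (theta * g x) ^+ 2)); last by all_moments.
rewrite /tilted_M mulrC -/c; congr (fine (expectation _ _) / _).
by apply/funext => w; rewrite -expRM_natl mulrA.
Qed.

Lemma mean_weight_le (x : R) :
  \int[L]_y (weight y * \1_(`]-oo, x]) y) = tilted_cdf X g theta x.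
Proof.
have Ie := all_moments_expR_tilt.
have I1 : all_moments L (fun y => expR (theta * g y) * \1_(`]-oo, x]) y).
  exact: (@all_moments_truncated _ _ _ (fun=> `]-oo, x]%classic) Ie
    (fun=> measurable_itv _) 0).
rewrite /tilted_cdf -/c.
under eq_Rintegral do rewrite /weight mulrAC mulrC.
rewrite meanZ// -(@mean_distribution (fun y => expR (theta * g y) * \1_(`]-oo, x]) y))//.
by rewrite mulrC.
Qed.

End tilted_law.

(** Here [A] stands for the weighted count, [B] for the total weight and [N] for the sample size. If
    [D >= N / 2], the term with 4 is already at least 1. Otherwise [B >= N / 2], so the ratio
    deviates by at most [4 D / N], and the term with [eps] is at least 1. *)
Lemma ratio_deviation_le (R : realFieldType) (N A B F D eps : R) :
  0 < N -> 0 < eps -> 0 <= F <= 1 -> `|A - N * F| <= D -> `|B - N| <= D ->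
  eps < `|A / B - F| -> 1 <= (4 + 16 / eps ^+ 2) * (D / N) ^+ 2.
Proof.
move=> N0 eps0 /andP[F0 F1] hA hB dev.
have D0 : 0 <= D := le_trans (normr_ge0 _) hA.
have e0 : 0 < eps ^+ 2 by rewrite exprn_gt0.
have sq0 : 0 <= (D / N) ^+ 2 by exact: sqr_ge0.
have s0 : 0 <= 16 / eps ^+ 2 * (D / N) ^+ 2.
  by rewrite mulr_ge0// divr_ge0// ltW.
rewrite mulrDl.
have [ND|DN] := leP (N / 2) D.
  have h : 1 / 2 <= D / N by rewrite ler_pdivlMr//; lra.
  have : 1 / 4 <= (D / N) ^+ 2 by nra.
  lra.
have B0 : 0 < B by move: hB; rewrite ler_norml => /andP[]; lra.
have h1 : `|A / B - F| <= 4 * (D / N).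
  rewrite (_ : A / B - F = (A - N * F + F * (N - B)) / B); last first.
    by field; rewrite gt_eqF.
  rewrite normrM normfV (gtr0_norm B0) ler_pdivrMr//.
  apply: le_trans (ler_normD _ _) _.
  have h2 : `|F * (N - B)| <= D.
    rewrite normrM (ger0_norm F0) distrC.
    by apply: le_trans hB; rewrite ler_piMl.
  have BN : N / 2 <= B by move: hB; rewrite ler_norml => /andP[]; lra.
  apply: (@le_trans _ _ (4 * (D / N) * (N / 2))); last first.
    by rewrite ler_wpM2l// mulr_ge0// divr_ge0// ltW.
  rewrite (_ : 4 * (D / N) * (N / 2) = 2 * D); last by field; rewrite gt_eqF.
  by lra.
have h3 : eps ^+ 2 <= 16 * (D / N) ^+ 2.
  have : eps ^+ 2 <= (4 * (D / N)) ^+ 2.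
    rewrite lerXn2r ?nnegrE//; [exact: ltW| |exact: ltW (lt_le_trans dev h1)].
    by rewrite mulr_ge0// divr_ge0// ltW.
  by rewrite exprMn; lra.
have : 1 <= 16 / eps ^+ 2 * (D / N) ^+ 2.
  by rewrite mulrAC ler_pdivlMr// mul1r.
lra.
Qed.

(** Continuity from below along the partial unions; it turns a bound uniform over finite grids into
    one for a countable set of points. *)
Lemma measure_bigcup_le d (T : measurableType d) (R : realType)
    (P : probability T R) (A : nat -> set T) (r : \bar R) :
  (forall k, measurable (A k)) ->
  (forall N, (P (\bigcup_(k in `I_N) A k) <= r)%E) ->
  (P (\bigcup_k A k) <= r)%E.
Proof.
move=> mA H.
have mB N : measurable (\bigcup_(k in `I_N) A k) by exact: bigcup_measurable.
have -> : \bigcup_k A k = \bigcup_N \bigcup_(k in `I_N) A k.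
  apply/seteqP; split => [w [k _ Ak]|w [N _ [k _ Ak]]]; last by exists k.
  by exists k.+1 => //; exists k => //=.
have cv : P (\bigcup_(k in `I_N) A k) @[N --> \oo] -->
    P (\bigcup_N \bigcup_(k in `I_N) A k).
  apply: nondecreasing_cvg_mu => //; first exact: bigcup_measurable.
  move=> m n mn; apply/subsetPset => w [k /= km Ak]; exists k => //=.
  exact: leq_trans km mn.
rewrite -(cvg_lim _ cv)//; apply: lime_le; first exact: cvgP cv.
by apply: nearW => N; exact: H.
Qed.

(** * Tail bound for the supremum distance *)

Section tail.
Context d0 (T0 : measurableType d0) (R : realType) (Q : probability T0 R).
Variables (X : {RV Q >-> R}) (g : {mfun R >-> R}).
Hypothesis finite_mgf : forall eta : R, 0 < eta ->
    ('E_Q[(fun w => expR (eta * g (X w)))%R] < +oo)%E.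
Hypothesis g_pos : (0 < Q [set w | 0 < g (X w)]%R)%E.
Context d (T : measurableType d) (P : probability T R).
Variable Xs : nat -> {RV P >-> R}.
Hypothesis indep : mutually_independent Xs.
Hypothesis same : forall i, same_distribution X (Xs i).
Variable theta : R.
Hypothesis theta0 : 0 < theta.

Let L : probability R R := distribution Q X.
Let f := weight X g theta.

Let law i (A : set R) : measurable A -> P (Xs i @^-1` A) = L A.
Proof. exact: same. Qed.

Let If : all_moments L f.
Proof. exact: all_moments_weight. Qed.

(** Dividing all weights by the same nonzero constant leaves the ratio unchanged. *)
Lemma tilted_ecdf_weight n w x : tilted_ecdf g Xs n theta w x =
  (\sum_(i < n) f (Xs i w) * \1_(`]-oo, x]) (Xs i w)) /
  (\sum_(i < n) f (Xs i w)).
Proof.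
have c0 := mean_expR_tilt_gt0 finite_mgf g_pos theta0.
rewrite /f /weight -mulr_suml.
under [X in _ = X / _]eq_bigr do rewrite mulrAC.
by rewrite -mulr_suml invfM invrK mulrACA mulVf ?mulr1// gt_eqF.
Qed.

Lemma tilted_M_gt0 : 0 < tilted_M X g theta.
Proof.
rewrite -mean_weight_sqr//.
apply: lt_le_trans (sqr_mean_le If).
by rewrite /L /f mean_weight// expr1n.
Qed.

(** Chebyshev's inequality for the dominating variable [B] of the maximal inequality; the same [B]
    controls all numerators and the total weight, hence a bound free of the grid. *)
Lemma grid_tail_le n (s : seq R) (D : set T) (eps : R) : (0 < n)%N -> 0 < eps ->
  measurable D ->
  (forall w, D w -> exists2 x, x \in s &
    eps < `|tilted_ecdf g Xs n theta w x - tilted_cdf X g theta x|) ->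
  (P D <= (22 ^+ 4 * (4 + 16 / eps ^+ 2) * (tilted_M X g theta / n%:R))%:E)%E.
Proof.
move=> n0 eps0 mD HD.
pose t := sort <=%R s.
(* Sorting the grid makes the half-lines nested. Index [size t] gives the full set and thus the
   total weight, while a grid point [x] is found at [index x t]. *)
pose e k : set R := if (k < size t)%N then `]-oo, nth 0 t k]%classic else setT.
have me k : measurable (e k) by rewrite /e; case: ifP.
have st : sorted <=%R t by apply: sort_sorted; exact: le_total.
have e_mono i j : (i <= j)%N -> e i `<=` e j.
  move=> ij; rewrite /e; case: (ltnP j (size t)) => jt; last by move=> ? _.
  rewrite (leq_ltn_trans ij jt) => y /=; rewrite !in_itv/= => /le_trans; apply.
  apply: sorted_leq_nth => //; first exact: le_trans.
  by rewrite inE (leq_ltn_trans ij jt).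
have M0 := tilted_M_gt0.
have f20 : 0 < \int[L]_x (f x ^+ 2) by rewrite mean_weight_sqr.
have [B [IB B0 BS Bm]] :=
  weighted_maximal_inequality indep law If me e_mono (size t) n0 f20.
have N0 : 0 < n%:R :> R by rewrite ltr0n.
have cM x : `|\sum_(i < n) f (Xs i x) - n%:R| <= B x.
  have := BS (size t) x (leqnn _); congr (`|_| <= _).
  rewrite /Xsum /centered.
  have eT : truncated f e (size t) = f.
    by apply/funext => y; rewrite /truncated /e ltnn indicT mulr1.
  by rewrite eT mean_weight// sumrB sumr_const card_ord.
have cF x w : x \in s ->
    `|\sum_(i < n) f (Xs i w) * \1_(`]-oo, x]) (Xs i w) -
      n%:R * tilted_cdf X g theta x| <= B w.
  move=> xs; have xt : x \in t by rewrite mem_sort.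
  have := BS (index x t) w (index_size _ _); congr (`|_| <= _).
  rewrite /Xsum /centered.
  have eT : truncated f e (index x t) = fun y => f y * \1_(`]-oo, x]) y.
    by apply/funext => y; rewrite /truncated /e index_mem xt nth_index.
  by rewrite eT mean_weight_le// sumrB sumr_const card_ord mulr_natl.
pose K := (4 + 16 / eps ^+ 2) / n%:R ^+ 2.
have K0 : 0 <= K.
  by rewrite divr_ge0// ?sqr_ge0// addr_ge0// divr_ge0// sqr_ge0.
(* Chebyshev's inequality in pointwise form: on [D] the deviation of the ratio forces
   [K B^2 >= 1]. *)
have dom w : \1_D w <= K * B w ^+ 2.
  rewrite indicE; have [wD|_] := boolP (w \in D); last first.
    by rewrite mulr_ge0// sqr_ge0.
  have [x xs dev] := HD w (set_mem wD).
  have := ratio_deviation_le N0 eps0 (tilted_cdf_itv X g theta x) (cF x w xs) (cM w).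
  rewrite -tilted_ecdf_weight => /(_ dev).
  by rewrite expr_div_n mulrA mulrAC.
have I1 : all_moments P (\1_D).
  apply: (all_moments_le _ (all_moments_cst P 1)); first exact: measurable_indic.
  by move=> x; rewrite normr1 indicE; case: (_ \in _); rewrite ?normr1 ?normr0.
have PD : P D = (\int[P]_w \1_D w)%:E.
  by rewrite /Rintegral integral_indic// setIT fineK// fin_num_measure.
rewrite PD lee_fin.
apply: le_trans (le_mean I1 _ dom) _; first by all_moments.
rewrite meanZ; last by all_moments.
apply: le_trans (ler_wpM2l K0 Bm) _.
rewrite mean_weight_sqr// /K le_eqVlt; apply/orP; left; apply/eqP.
by field; rewrite !gt_eqF.
Qed.

(** The supremum may be taken over the rationals, so its exceedance event lies in a countable union
    whose finite parts all satisfy the same grid bound. *)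
Lemma tilted_sup_dist_tail_le n (eps : R) : (0 < n)%N -> 0 < eps ->
  (P [set w | eps < tilted_sup_dist X g Xs n theta w]%R
    <= (22 ^+ 4 * (4 + 16 / eps ^+ 2) * (tilted_M X g theta / n%:R))%:E)%E.
Proof.
move=> n0 eps0.
pose r k : R := ratr (odflt 0 (unpickle k)).
pose A k := [set w | eps < `|tilted_ecdf g Xs n theta w (r k)
  - tilted_cdf X g theta (r k)|].
have mA k : measurable (A k).
  rewrite [A k](_ : _ = (fun w => `|tilted_ecdf g Xs n theta w (r k)
    - tilted_cdf X g theta (r k)|) @^-1` `]eps, +oo[); last first.
    by apply/seteqP; split => w; rewrite /A/= in_itv/= andbT.
  rewrite -[X in measurable X]setTI; apply: measurableT_comp => //.
  apply: measurable_funB => //; exact: measurable_tilted_ecdf.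
apply: (@le_trans _ _ (P (\bigcup_k A k))).
  apply: le_measure; rewrite ?inE.
  - rewrite [X in measurable X](_ : _ =
      tilted_sup_dist X g Xs n theta @^-1` `]eps, +oo[); last first.
      by apply/seteqP; split => w; rewrite /= in_itv/= andbT.
    rewrite -[X in measurable X]setTI; exact: measurable_tilted_sup_dist.
  - exact: bigcup_measurable.
  move=> w /=; rewrite tilted_sup_distE => lt; apply: contrapT => nA.
  move: lt; rewrite ltNge => /negP; apply; rewrite /sups/=.
  apply: ge_sup; first by eexists; exists 0%N.
  move=> _ [k _ <-]; rewrite leNgt; apply/negP => lt; apply: nA.
  by exists k.
apply: measure_bigcup_le => // N.
apply: (grid_tail_le (s := [seq r k | k <- iota 0 N])) => //.
  exact: bigcup_measurable.
move=> w [k /= kN Ak]; exists (r k) => //.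
by apply: map_f; rewrite mem_iota.
Qed.

End tail.

(** * Convergence in distribution to zero and conclusion *)

Lemma tilted_sup_dist_ge0 d0 (T0 : measurableType d0) (R : realType)
    (Q : probability T0 R) (X : {RV Q >-> R}) (g : {mfun R >-> R})
    d (T : measurableType d) (P : probability T R) (Xs : nat -> {RV P >-> R})
    n (theta : R) (w : T) : 0 <= tilted_sup_dist X g Xs n theta w.
Proof.
apply: le_trans (normr_ge0 (tilted_ecdf g Xs n theta w 0 - tilted_cdf X g theta 0)) _.
apply: ub_le_sup; last by exists 0.
by exists 1 => _ [x _ <-]; exact: tilted_dist_le1.
Qed.

Section degenerate.
Context d (T : measurableType d) (R : realType) (P : probability T R).

Lemma cdf_cst0 (x : R) :
  cdf (cst 0 : {RV P >-> R}) x = ((0 <= x)%R%:R%:E : \bar R).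
Proof.
rewrite /cdf /distribution /pushforward.
have [x0|x0] := leP 0 x.
  rewrite (_ : _ @^-1` _ = setT) ?probability_setT//.
  by apply/seteqP; split => // w _; rewrite /= in_itv.
rewrite (_ : _ @^-1` _ = set0) ?measure0//.
by apply/seteqP; split => // w; rewrite /= in_itv/= leNgt x0.
Qed.

Lemma cvg_in_distribution0 (Y : nat -> {RV P >-> R}) :
  (forall n w, (0 < n)%N -> 0 <= Y n w) ->
  (forall eps : R, 0 < eps -> exists delta : nat -> R,
    delta n @[n --> \oo] --> (0 : R) /\
    forall n, (0 < n)%N -> (P [set w | eps < Y n w]%R <= (delta n)%:E)%E) ->
  cvg_in_distribution Y (cst 0 : {RV P >-> R}).
Proof.
move=> Y0 tail x cx; rewrite cdf_cst0.
have [x0|x0|x0] := ltgtP x 0; last first.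
(* Continuity at zero would make the value 1 there equal to the left limit 0. *)
- exfalso; move: cx; rewrite x0 /prop_for /continuous_at cdf_cst0 lexx => cx.
  have c1 : cdf (cst 0 : {RV P >-> R}) y @[y --> 0^'-] --> (1%:E : \bar R).
    exact: cvg_within_filter cx.
  have c0 : cdf (cst 0 : {RV P >-> R}) y @[y --> 0^'-] --> (0%:E : \bar R).
    apply: cvg_near_cst; near=> y; rewrite cdf_cst0 leNgt.
    by rewrite (_ : y < 0)//; near: y; exact: nbhs_left_lt.
  have : (1%:E : \bar R) = 0%:E by exact: (cvg_unique (@ereal_hausdorff R) c1 c0).
  by move=> /eqP; rewrite eqe oner_eq0.
- have [delta [cd Hd]] := tail x x0.
  apply: (@squeeze_cvge _ _ _ _ (fun n => (1 - delta n)%:E) _ (fun=> 1%E)).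
  + near=> n; rewrite cdf_le1 andbT.
    have n0 : (0 < n)%N by near: n; exact: nbhs_infty_gt.
    have mA : measurable [set w | x < Y n w].
      rewrite [X in measurable X](_ : _ = Y n @^-1` `]x, +oo[); last first.
        by apply/seteqP; split => w; rewrite /= in_itv/= andbT.
      exact: measurable_funPTI.
    have -> : cdf (Y n) x = P (~` [set w | x < Y n w]).
      rewrite /cdf /distribution /pushforward; congr (P _).
      by apply/seteqP; split => w; rewrite /= in_itv/= leNgt => /negP.
    rewrite probability_setC// EFinB leeB//; exact: Hd.
  + apply: cvg_EFin; first by near=> n.
    rewrite -[X in _ --> X]subr0; apply: cvgB => //; exact: cvg_cst.
  + exact: cvg_cst.
- apply: cvg_near_cst; near=> n.
  have n0 : (0 < n)%N by near: n; exact: nbhs_infty_gt.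
  rewrite /cdf /distribution /pushforward (_ : _ @^-1` _ = set0) ?measure0//.
  apply/seteqP; split => // w /=; rewrite in_itv/= => /le_lt_trans/(_ x0).
  by rewrite ltNge Y0.
Unshelve. all: by end_near. Qed.

End degenerate.

Theorem theorem2 (R : realType)
    (d0 : measure_display) (T0 : measurableType d0) (Q : probability T0 R)
    (X : {RV Q >-> R}) (g : {mfun R >-> R})
    (d : measure_display) (T : measurableType d) (P : probability T R)
    (Xs : nat -> {RV P >-> R}) (theta s : nat -> R) :
  (forall eta : R, 0 < eta ->
    ('E_Q[(fun w => expR (eta * g (X w)))%R] < +oo)%E) ->
  (0 < Q [set w | 0 < g (X w)]%R)%E ->
  mutually_independent Xs ->
  (forall i, same_distribution X (Xs i)) ->
  (forall n, (1 <= n)%N -> 0 < theta n) ->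
  tilted_M X g (theta n) / n%:R @[n --> \oo] --> (0 : R) ->
  (forall n, (1 <= n)%N -> 0 < s n) ->
  s n ^+ 2 * tilted_M X g (theta n) / n%:R @[n --> \oo] --> (0 : R) ->
  cvg_in_distribution
    (fun n => s n *: (tilted_sup_dist X g Xs n (theta n) : {RV P >-> R}))
    (cst 0 : {RV P >-> R}).
Proof.
move=> mgf g_pos indep same theta0 cM s0 csM.
apply: cvg_in_distribution0 => [n w n0|eps eps0].
  by rewrite /= mulr_ge0 ?tilted_sup_dist_ge0// ltW// s0.
(* This is the tail bound at level [eps / s n]: the square of [s n] comes out of
   [16 / (eps / s n)^2], and the two summands are constant multiples of the two sequences assumed to
   tend to zero. *)
exists (fun n => 22 ^+ 4 * (4 * (tilted_M X g (theta n) / n%:R) +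
  16 / eps ^+ 2 * (s n ^+ 2 * tilted_M X g (theta n) / n%:R))); split.
  rewrite [X in _ --> X](_ : _ = 22 ^+ 4 * (4 * 0 + 16 / eps ^+ 2 * 0)); last by ring.
  apply: cvgM; first exact: cvg_cst.
  by apply: cvgD; apply: cvgM => //; exact: cvg_cst.
move=> n n0; have sn := s0 n n0.
have -> : [set w | eps < (s n *: (tilted_sup_dist X g Xs n (theta n) : {RV P >-> R})) w] =
  [set w | eps / s n < tilted_sup_dist X g Xs n (theta n) w].
  by apply/seteqP; split => w /=; rewrite ltr_pdivrMr// mulrC.
have e0 : 0 < eps / s n by rewrite divr_gt0.
apply: le_trans (tilted_sup_dist_tail_le mgf g_pos indep same (theta0 n n0) n0 e0) _.
rewrite lee_fin le_eqVlt; apply/orP; left; apply/eqP.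
by field; rewrite pnatr_eq0 -lt0n n0 !gt_eqF.
Qed.
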